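(* Let $R$ be a commutative ring. Then $R$ has the strong Weierstrass property if and only if $R$ is a complete principal ideal ring. In particular, $R$ has the strong Weierstrass property precisely when there exist a natural number $m$ and rings $R_1,\ldots,R_m$ such that $$R\cong R_1\times\cdots\times R_m,$$ where for each $i$ the ring $R_i$ is either a complete discrete valuation ring or an Artinian local principal ideal ring.
   Context: All rings are commutative with a nonzero identity. A ring $R$ has the strong Weierstrass property if every power series $f(x)\in R[[x]]$ factors as $f(x)=p(x)u(x)$ with $p(x)\in R[x]$ a polynomial and $u(x)\in R[[x]]^{\times}$ a unit of $R[[x]]$. A local ring $R$ with maximal ideal $P$ is called complete if the natural map $R\to\widehat{R}=\varprojlim_n R/P^n$ is an isomorphism. A principal ideal ring is a ring in which every ideal is principal (it need not be a domain). ''Complete principal ideal ring'' means a ring isomorphic to a finite product of complete local principal ideal rings. Fields count as Artinian local principal ideal rings. *)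

(* Defs.v *)
From HB Require Import structures.
From mathcomp Require Import all_boot all_algebra.
From mathcomp Require Import boolp classical_sets functions.

Set Implicit Arguments.
Unset Strict Implicit.
Unset Printing Implicit Defensive.

Import GRing.Theory.

Local Open Scope classical_set_scope.
Local Open Scope ring_scope.

(* A record, rather than an alias of nat -> R, because functions.v already
   equips nat -> R with the pointwise ring structure. *)
Record pseries (R : Type) := PSeries { coefs : nat -> R }.

HB.instance Definition _ (R : Type) := gen_eqMixin (pseries R).
HB.instance Definition _ (R : Type) := gen_choiceMixin (pseries R).

Section PowerSeriesRing.
Variable R : comNzRingType.
Implicit Types f g h : pseries R.

Lemma pseriesP f g : (forall n, coefs f n = coefs g n) -> f = g.
Proof. by case: f g => [f] [g] /= fg; congr PSeries; apply/funext. Qed.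

Definition ps_add f g := PSeries (fun n => coefs f n + coefs g n).
Definition ps_opp f := PSeries (fun n => - coefs f n).
Definition ps_zero : pseries R := PSeries (fun=> 0).
Definition ps_one : pseries R := PSeries (fun n => (n == 0%N)%:R).
Definition ps_mul f g :=
  PSeries (fun n => \sum_(i < n.+1) coefs f i * coefs g (n - i)%N).

Let trunc n f : {poly R} := \poly_(i < n.+1) coefs f i.

Let coef_trunc n f i : (i <= n)%N -> (trunc n f)`_i = coefs f i.
Proof. by move=> le_in; rewrite coef_poly ltnS le_in. Qed.

Let coef_mul n f g i : (i <= n)%N ->
  (trunc n f * trunc n g)`_i = coefs (ps_mul f g) i.
Proof.
move=> le_in; rewrite coefM; apply: eq_bigr => j _.
have le_ji : (j <= i)%N by rewrite -ltnS.
by rewrite !coef_trunc // ?(leq_trans (leq_subr _ _)) ?(leq_trans le_ji).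
Qed.

Let ps_addA : associative ps_add.
Proof. by move=> f g h; apply: pseriesP => n; exact: addrA. Qed.
Let ps_addC : commutative ps_add.
Proof. by move=> f g; apply: pseriesP => n; exact: addrC. Qed.
Let ps_add0 : left_id ps_zero ps_add.
Proof. by move=> f; apply: pseriesP => n; exact: add0r. Qed.
Let ps_addN : left_inverse ps_zero ps_opp ps_add.
Proof. by move=> f; apply: pseriesP => n; exact: addNr. Qed.

Let ps_mulC : commutative ps_mul.
Proof.
by move=> f g; apply: pseriesP => n; rewrite -!(coef_mul _ _ (leqnn n)) mulrC.
Qed.

Let ps_mulA : associative ps_mul.
Proof.
move=> f g h; apply: pseriesP => n.
transitivity ((trunc n f * trunc n g * trunc n h)`_n).
  rewrite -mulrA coefM; apply: eq_bigr => j _.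
  have le_jn : (j <= n)%N by rewrite -ltnS.
  by rewrite coef_mul ?leq_subr // coef_trunc.
rewrite coefM; apply: eq_bigr => j _; have le_jn : (j <= n)%N by rewrite -ltnS.
by rewrite coef_mul // coef_trunc // leq_subr.
Qed.

Let ps_mul1 : left_id ps_one ps_mul.
Proof.
move=> f; apply: pseriesP => n /=; rewrite big_ord_recl /= mul1r subn0.
by rewrite big1 ?addr0 // => i _; rewrite mul0r.
Qed.

Let ps_mulDl : left_distributive ps_mul ps_add.
Proof.
move=> f g h; apply: pseriesP => n /=; rewrite -big_split /=.
by apply: eq_bigr => i _; rewrite mulrDl.
Qed.

Let ps_one_neq0 : ps_one != ps_zero.
Proof.
apply/eqP => /(congr1 (fun f => coefs f 0%N)) /= /eqP.
by rewrite (oner_eq0 R).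
Qed.

HB.instance Definition _ := GRing.isZmodule.Build (pseries R)
  ps_addA ps_addC ps_add0 ps_addN.
HB.instance Definition _ := GRing.Zmodule_isComNzRing.Build (pseries R)
  ps_mulA ps_mulC ps_mul1 ps_mulDl ps_one_neq0.

End PowerSeriesRing.

Definition pseries_of_poly (R : comNzRingType) (p : {poly R}) : pseries R :=
  PSeries (fun n => p`_n).

(* GRing.unit needs a unitRingType, which a comNzRingType need not be. *)
Definition invertible (R : comNzRingType) (x : R) : Prop := exists y, x * y = 1.

Definition strong_weierstrass (R : comNzRingType) : Prop :=
  forall f : pseries R, exists (p : {poly R}) (u : pseries R),
    invertible u /\ f = pseries_of_poly p * u.

Section Ideals.
Variable R : comNzRingType.
Implicit Types I J P Q : set R.

(* The library's idealr is a boolean predicate and is always proper. *)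
Definition is_ideal I : Prop :=
  [/\ I 0, forall x y, I x -> I y -> I (x + y) & forall r x, I x -> I (r * x)].

Definition is_maximal_ideal P : Prop :=
  [/\ is_ideal P, P <> setT &
      forall J, is_ideal J -> P `<=` J -> J = P \/ J = setT].

Definition local_at P : Prop :=
  is_maximal_ideal P /\ forall Q, is_maximal_ideal Q -> Q = P.

Definition ideal_mul I J : set R :=
  [set x | exists2 s : seq (R * R),
     forall p, p \in s -> I p.1 /\ J p.2 & x = \sum_(p <- s) p.1 * p.2].

Definition ideal_exp P (n : nat) : set R := iter n (ideal_mul P) setT.

Definition coset I (r : R) : set R := [set x | I (x - r)].

(* The inverse limit of the rings R / P^n, an element of R / P^n being a coset
   of P^n: the transition map sends a coset of P^(n+1) to the unique coset of
   P^n that contains it. *)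
Definition completion P : set (nat -> set R) :=
  [set c | (forall n, exists r, c n = coset (ideal_exp P n) r) /\
           (forall n, c n.+1 `<=` c n)].

Definition to_completion P (r : R) : nat -> set R :=
  fun n => coset (ideal_exp P n) r.

(* to_completion is a ring morphism for the ring structure of the inverse
   limit, so it is an isomorphism exactly when it is bijective. *)
Definition complete_at P : Prop := set_bij setT (completion P) (to_completion P).

End Ideals.

Definition local_ring (R : comNzRingType) : Prop := exists P : set R, local_at P.

Definition complete_local_ring (R : comNzRingType) : Prop :=
  exists P : set R, local_at P /\ complete_at P.

Definition principal_ideal_ring (R : comNzRingType) : Prop :=
  forall I : set R, is_ideal I -> exists a : R, I = [set r * a | r in [set: R]].

Definition artinian (R : comNzRingType) : Prop :=
  forall I : nat -> set R, (forall n, is_ideal (I n)) ->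
    (forall n, I n.+1 `<=` I n) ->
  exists N, forall n, (N <= n)%N -> I n = I N.

Definition is_field (R : comNzRingType) : Prop :=
  forall x : R, x != 0 -> invertible x.

Definition discrete_valuation_ring (R : comNzRingType) : Prop :=
  [/\ GRing.integral_domain_axiom R, principal_ideal_ring R, local_ring R &
      ~ is_field R].

(* A ring morphism to the product of the S i amounts to a family of ring
   morphisms to the factors. *)
Definition isomorphic_to_product (R : comNzRingType) (m : nat)
    (S : 'I_m -> comNzRingType) : Prop :=
  exists phi : forall i, {rmorphism R -> S i},
    bijective (fun (r : R) (i : 'I_m) => phi i r).

Definition complete_principal_ideal_ring (R : comNzRingType) : Prop :=
  exists (m : nat) (S : 'I_m -> comNzRingType),
    isomorphic_to_product R S /\
    forall i, complete_local_ring (S i) /\ principal_ideal_ring (S i).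

(* Main.v *)
(* If R is a finite product of complete local principal ideal rings, pull the
   largest possible power of the uniformizer out of a series on each factor and
   apply Weierstrass preparation.

   Conversely let R have the strong Weierstrass property. A series and its
   associated polynomial have the same content, so R is noetherian, hence a
   finite product of connected rings, which inherit the property. The series
   b + a sum_k x^(2^k) shows that R is arithmetical; therefore, if R is
   connected, each a is nilpotent or regular, and the series
   sum_n k_n x^n with k_n = a k_(n+1) gives Krull's intersection theorem.
   The main step: an element alpha = 1 mod a of the a-adic completion is such
   that a alpha is a root of some series - a + x + ..., hence of a polynomial,
   which yields alpha w(a alpha) = 1 with w in R[x]. For alpha = 1 + a s in R
   this makes 1 + a s a unit, so R is local, and it is a principal ideal ring
   because it is arithmetical. For general alpha, applying this to alpha and to
   its inverse shows that R[alpha] is finite over R and equal to R + a R[alpha],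
   so alpha is in R by Nakayama's lemma, and R is complete. *)
Require Import Defs.
From mathcomp Require Import all_boot all_algebra.
From HB Require Import structures.
From mathcomp Require Import boolp classical_sets functions.
From mathcomp Require Import ring.

Set Implicit Arguments.
Unset Strict Implicit.
Unset Printing Implicit Defensive.

Import GRing.Theory.

Local Open Scope classical_set_scope.
Local Open Scope ring_scope.

(** * Divisibility *)

Section Divisibility.
Variable R : comNzRingType.
Implicit Types a b c x y : R.

Definition divides a x : Prop := exists y, x = a * y.

Lemma dividesrr a : divides a a.
Proof. by exists 1; rewrite mulr1. Qed.

Lemma divides0 a : divides a 0.
Proof. by exists 0; rewrite mulr0. Qed.

Lemma divides1l x : divides 1 x.
Proof. by exists x; rewrite mul1r. Qed.

Lemma dividesD a x y : divides a x -> divides a y -> divides a (x + y).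
Proof. by move=> [u ->] [v ->]; exists (u + v); rewrite mulrDr. Qed.

Lemma dividesMl a x y : divides a x -> divides a (y * x).
Proof. by move=> [u ->]; exists (y * u); rewrite mulrCA. Qed.

Lemma dividesMr a x y : divides a x -> divides a (x * y).
Proof. by move=> ?; rewrite mulrC; exact: dividesMl. Qed.

Lemma dividesN a x : divides a x -> divides a (- x).
Proof. by move=> /(dividesMl (-1)); rewrite mulN1r. Qed.

Lemma dividesB a x y : divides a x -> divides a y -> divides a (x - y).
Proof. by move=> ax ay; apply: dividesD => //; exact: dividesN. Qed.

Lemma dividesBC a x y : divides a (x - y) -> divides a (y - x).
Proof. by move=> /dividesN; rewrite opprB. Qed.

Lemma dividesM a b x y : divides a x -> divides b y -> divides (a * b) (x * y).
Proof. by move=> [u ->] [v ->]; exists (u * v); rewrite mulrACA. Qed.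

Lemma divides_trans a b x : divides a b -> divides b x -> divides a x.
Proof. by move=> [u ->] [v ->]; exists (u * v); rewrite mulrA. Qed.

Lemma divides_sum (I : Type) (r : seq I) (Q : pred I) a (F : I -> R) :
  (forall i, Q i -> divides a (F i)) -> divides a (\sum_(i <- r | Q i) F i).
Proof.
by move=> aF; apply: big_ind => //; [exact: divides0 | exact: dividesD].
Qed.

Lemma divides_exp a x n : divides a x -> divides (a ^+ n) (x ^+ n).
Proof. by move=> [u ->]; exists (u ^+ n); rewrite exprMn. Qed.

Lemma divides_exp_le a m n : (m <= n)%N -> divides (a ^+ m) (a ^+ n).
Proof. by move=> le_mn; exists (a ^+ (n - m)); rewrite -exprD subnKC. Qed.

Lemma divides_horner a (p : {poly R}) x y :
  divides a (x - y) -> divides a (p.[x] - p.[y]).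
Proof.
move=> axy; elim/poly_ind: p => [|p c IHp].
  by rewrite !horner0 subrr; exact: divides0.
rewrite !hornerMXaddC.
have -> : p.[x] * x + c - (p.[y] * y + c) =
  (p.[x] - p.[y]) * x + p.[y] * (x - y) by ring.
by apply: dividesD; [exact: dividesMr | exact: dividesMl].
Qed.

Lemma divides_is_ideal a : is_ideal (divides a).
Proof. by split=> *; [exact: divides0 | exact: dividesD | exact: dividesMl]. Qed.

Lemma principalE a : [set r * a | r in [set: R]] = divides a.
Proof.
apply/seteqP; split=> [x [r _ <-]|x [r ->]]; first by exists r; rewrite mulrC.
by exists r; rewrite // mulrC.
Qed.

Lemma ann_is_ideal a : is_ideal [set x | x * a = 0].
Proof.
split=> /= [|x y xa ya|r x xa]; first exact: mul0r.
  by rewrite mulrDl xa ya addr0.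
by rewrite -mulrA xa mulr0.
Qed.

Lemma ideal_sum (I : set R) (J : Type) (r : seq J) (Q : pred J) (F : J -> R) :
  is_ideal I -> (forall j, Q j -> I (F j)) -> I (\sum_(j <- r | Q j) F j).
Proof. by move=> [I0 ID _] IF; apply: big_ind. Qed.

Lemma ideal_one_setT (I : set R) : is_ideal I -> I 1 -> I = setT.
Proof.
move=> [_ _ IM] I1; apply/seteqP; split=> // x _.
by rewrite -[x]mulr1; exact: IM.
Qed.

Lemma invertibleM x y : invertible x -> invertible y -> invertible (x * y).
Proof.
by move=> [x' xx'] [y' yy']; exists (x' * y'); rewrite mulrACA xx' yy' mulr1.
Qed.

Lemma invertibleMr x y : invertible (x * y) -> invertible y.
Proof. by move=> [z xyz]; exists (x * z); rewrite mulrCA mulrA. Qed.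

Lemma invertibleMl x y : invertible (x * y) -> invertible x.
Proof. by rewrite mulrC; exact: invertibleMr. Qed.

Lemma invertible_1Bnil x n : x ^+ n = 0 -> invertible (1 - x).
Proof.
move=> xn0; exists (\sum_(i < n) x ^+ i).
by rewrite -opprB mulNr -subrX1 xn0 sub0r opprK.
Qed.

End Divisibility.

(** * Power series *)

(** Dependent choice for sequences: [Q n] sees only the first [n] terms, so prefixes are extended
    one term at a time and the diagonal sequence satisfies every [Q n]. *)
Lemma greedy_seq (T : Type) (t0 : T) (Q : nat -> (nat -> T) -> Prop) :
  (forall n s s', (forall i, (i < n)%N -> s i = s' i) -> Q n s -> Q n s') ->
  (forall s, Q 0%N s) ->
  (forall n s, Q n s ->
     exists t, Q n.+1 (fun i => if (i < n)%N then s i else t)) ->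
  exists s, forall n, Q n s.
Proof.
move=> Qext Q0 QS.
have /choice[next nextP] (ns : nat * (nat -> T)) : exists t, Q ns.1 ns.2 ->
    Q ns.1.+1 (fun i => if (i < ns.1)%N then ns.2 i else t).
  by have [/QS[t]|] := pselect (Q ns.1 ns.2); [exists t | exists t0].
pose pre := fix pre n : nat -> T := if n is m.+1 then
  fun i => if (i < m)%N then pre m i else next (m, pre m) else fun=> t0.
have Qpre n : Q n (pre n).
  by elim: n => [|n IHn]; [exact: Q0 | exact: (nextP (n, pre n))].
have preE i m : (i < m)%N -> pre m i = pre i.+1 i.
  elim: m => // m IHm; rewrite ltnS leq_eqVlt => /predU1P[-> //|lt_im].
  by rewrite -IHm //= lt_im.
by exists (fun i => pre i.+1 i) => n; apply: Qext (Qpre n) => i /preE.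
Qed.

Section PowerSeries.
Variable R : comNzRingType.
Implicit Types (f g h u v : pseries R) (p q : {poly R}) (a b c : R).

Lemma coef_psM f g n :
  coefs (f * g) n = \sum_(i < n.+1) coefs f i * coefs g (n - i)%N.
Proof. by []. Qed.

Lemma coef_psM0 f g : coefs (f * g) 0%N = coefs f 0%N * coefs g 0%N.
Proof. by rewrite coef_psM big_ord1. Qed.

Lemma coef_psD f g n : coefs (f + g) n = coefs f n + coefs g n.
Proof. by []. Qed.

Lemma coef_psCM c f n : coefs (pseries_of_poly c%:P * f) n = c * coefs f n.
Proof.
rewrite coef_psM big_ord_recl /= coefC subn0 big1 ?addr0 // => i _.
by rewrite coefC mul0r.
Qed.

Lemma pseries_of_polyM p q :
  pseries_of_poly (p * q) = pseries_of_poly p * pseries_of_poly q.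
Proof. by apply: pseriesP => n /=; rewrite coefM. Qed.

Lemma ps_invertible u : invertible (coefs u 0%N) -> invertible u.
Proof.
move=> [w uw1].
pose Q n s := forall i, (i < n)%N -> coefs (u * PSeries s) i = (i == 0%N)%:R.
have [|//|n s Qns|s Qs] := @greedy_seq R 0 Q.
- move=> n s s' ss' Qn i lt_in; rewrite -(Qn i lt_in); apply: eq_bigr => j _ /=.
  by rewrite ss' //; apply: leq_ltn_trans lt_in; exact: leq_subr.
(* [S] is what the coefficients already chosen contribute in degree [n]; the new one solves a linear
   equation with unit leading coefficient. *)
- pose S := \sum_(i < n) coefs u i.+1 * s (n - i.+1)%N.
  exists (w * ((n == 0%N)%:R - S)) => i; rewrite ltnS leq_eqVlt.
  case/predU1P=> [->|lt_in].
    rewrite coef_psM big_ord_recl /= subn0 ltnn mulrA uw1 mul1r.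
    apply: (canLR (subrK _)); congr (_ - _); apply: eq_bigr => j _ /=.
    by rewrite /bump add1n ltn_subrL (leq_ltn_trans _ (ltn_ord j)).
  rewrite -(Qns i lt_in); apply: eq_bigr => j _ /=.
  by rewrite (leq_ltn_trans _ lt_in) // leq_subr.
by exists (PSeries s); apply: pseriesP => n; exact: Qs (ltnSn n).
Qed.

Definition ps_trunc n f : {poly R} := \poly_(i < n) coefs f i.

(** A congruence modulo ['X^n], with an explicit cofactor so that it can be evaluated at a point. *)
Lemma ps_truncM n f g :
  exists r, ps_trunc n f * ps_trunc n g = ps_trunc n (f * g) + r * 'X^n.
Proof.
exists (drop_poly n (ps_trunc n f * ps_trunc n g)).
rewrite -[LHS](poly_take_drop n); congr (_ + _).
apply/polyP=> i; rewrite coef_take_poly coef_poly; case: ifP => // lt_in.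
rewrite coefM; apply: eq_bigr => j _; rewrite !coef_poly.
by rewrite !(leq_ltn_trans _ lt_in) ?leq_subr // -ltnS.
Qed.

Lemma ps_trunc_poly n p :
  exists r, p = ps_trunc n (pseries_of_poly p) + r * 'X^n.
Proof.
by exists (drop_poly n p); rewrite -[LHS](poly_take_drop n).
Qed.

End PowerSeries.

(** * Content of a power series *)

Section Content.
Variable R : comNzRingType.
Hypothesis swR : strong_weierstrass R.
Implicit Types (a b c : R).

(** Multiplying by the inverse of the unit factor, rescaled by the constant coefficient of that
    unit, turns [f] into a polynomial. *)
Lemma sw_normalized (f : pseries R) : exists (v : pseries R) (p : {poly R}),
  coefs v 0%N = 1 /\ forall n, coefs (f * v) n = p`_n.
Proof.
have [p [u [[y uy1] ->]]] := swR f.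
pose c := coefs u 0%N; exists (pseries_of_poly c%:P * y), (p * c%:P); split.
  by rewrite coef_psCM -coef_psM0 uy1.
by move=> n; rewrite mulrCA -mulrA uy1 mulr1 -pseries_of_polyM mulrC.
Qed.

(* The content of a power series is that of the associated polynomial, hence
   is generated by finitely many coefficients. *)
Lemma sw_content (a : nat -> R) : exists N, forall I, is_ideal I ->
  (forall i, (i < N)%N -> I (a i)) -> forall n, I (a n).
Proof.
have [v [p [v01 fvp]]] := sw_normalized (PSeries a).
have [y vy1] : invertible v.
  by apply: ps_invertible; rewrite v01; exists 1; rewrite mulr1.
exists (size p) => I I_ideal Ia n; have [I0 ID IM] := I_ideal.
have Ip i : I p`_i.
  case: (ltnP i (size p)) => [lt_ip|/(nth_default 0) -> //].
  rewrite -fvp coef_psM; apply: ideal_sum => // j _; rewrite mulrC; apply: IM.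
  by apply: Ia; apply: leq_ltn_trans lt_ip; rewrite -ltnS.
have -> : a n = coefs (pseries_of_poly p * y) n.
  have -> : pseries_of_poly p = PSeries a * v.
    by apply: pseriesP => m; rewrite fvp.
  by rewrite -mulrA vy1 mulr1.
by rewrite coef_psM; apply: ideal_sum => // j _; rewrite mulrC; exact: IM (Ip _).
Qed.

End Content.

(** * Chain conditions *)

Definition ideal_acc (R : comNzRingType) : Prop :=
  forall I : nat -> set R, (forall n, is_ideal (I n)) ->
    (forall n, I n `<=` I n.+1) -> exists N, forall n, I n `<=` I N.

Lemma increasing_sets (T : Type) (I : nat -> set T) :
  (forall n, I n `<=` I n.+1) -> forall m n, (m <= n)%N -> I m `<=` I n.
Proof.
move=> IS m n /subnK <-; elim: (n - m)%N => //= k IHk; rewrite addSn.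
exact: subset_trans IHk (IS _).
Qed.

Lemma ideal_acc_max (R : comNzRingType) (S : set (set R)) (I0 : set R) :
  ideal_acc R -> (forall I, S I -> is_ideal I) -> S I0 ->
  exists M, S M /\ forall J, S J -> M `<=` J -> J `<=` M.
Proof.
move=> accR S_ideal SI0; apply: contrapT => noM.
have /choice[next nextP] (M : set R) :
    exists J, S M -> [/\ S J, M `<=` J & ~ J `<=` M].
  have [SM|nSM] := pselect (S M); last by exists M.
  apply: contrapT => noJ; apply: noM; exists M; split=> // J SJ MJ.
  by apply: contrapT => nJM; apply: noJ; exists J.
have SI n : S (iter n next I0) by elim: n => //= n /nextP[].
have [n|n|N IN] := accR (fun n => iter n next I0).
- exact: S_ideal.
- by have [] := nextP _ (SI n).
by have [_ _] := nextP _ (SI N); apply; exact: (IN N.+1).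
Qed.

Lemma pir_acc (R : comNzRingType) : principal_ideal_ring R -> ideal_acc R.
Proof.
move=> pirR I I_ideal IS.
have U_ideal : is_ideal [set x | exists n, I n x].
  split=> /= [|x y [m Imx] [n Iny]|r x [n Inx]].
  - by exists 0%N; have [] := I_ideal 0%N.
  - exists (maxn m n); have [_ ID _] := I_ideal (maxn m n).
    apply: ID; first exact: (increasing_sets IS (leq_maxl m n)) Imx.
    exact: (increasing_sets IS (leq_maxr m n)) Iny.
  - by exists n; have [_ _ IM] := I_ideal n; exact: IM.
have [c] := pirR _ U_ideal; rewrite principalE => Uc.
have [N INc] : [set x | exists n, I n x] c by rewrite Uc; exact: dividesrr.
exists N => n x Inx; have : [set x | exists n, I n x] x by exists n.
by rewrite Uc => -[r ->]; have [_ _ IM] := I_ideal N; rewrite mulrC; exact: IM.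
Qed.

(** * Noetherianity, arithmeticality and Krull intersection *)

Section KrullAndArithmetical.
Variable R : comNzRingType.
Hypothesis swR : strong_weierstrass R.
Implicit Types (a b c : R).

(** In a chain that never stabilizes, pick for each [N] a later element outside [I N]. By
    [sw_content] the first [M] of these generate all others, yet they lie in a single [I N']. *)
Lemma sw_acc : ideal_acc R.
Proof.
move=> I I_ideal IS; apply: contrapT => noN.
have /choice[nx nxP] N : exists nx, I nx.1 nx.2 /\ ~ I N nx.2.
  apply: contrapT => none; apply: noN; exists N => n x Inx.
  by apply: contrapT => nINx; apply: none; exists (n, x).
have [M aM] := sw_content swR (fun N => (nx N).2).
pose N' := \max_(i < M) (nx i).1.
apply: (nxP N').2; apply: (aM _ (I_ideal N')) => i lt_iM.
apply: (increasing_sets IS _) (nxP i).1.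
exact: (@leq_bigmax _ (fun i : 'I_M => (nx i).1) (Ordinal lt_iM)).
Qed.

(* Applied to f = b + a * sum_k x^(2^k): the gaps of f make every v_(n - j)
   below satisfy a | v_(n - j) b. *)
Lemma sw_arithmetical a b :
  exists i, divides a (i * b) /\ divides b ((1 - i) * a).
Proof.
pose h j : R := (j == 2 ^ trunc_log 2 j)%N%:R.
pose f := PSeries (fun j => if j == 0%N then b else a * h j).
have [v [p [v01 fvp]]] := sw_normalized swR f; pose N := size p.
have fvE n : coefs (f * v) n =
    coefs v n * b + a * \sum_(j < n) h j.+1 * coefs v (n - j.+1)%N.
  rewrite coef_psM big_ord_recl /= subn0 mulrC; congr (_ + _).
  by rewrite mulr_sumr; apply: eq_bigr => j _; rewrite /= mulrA.
have va n : (N <= n)%N -> divides a (coefs v n * b).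
  move=> /(nth_default 0)/esym/eqP; rewrite -fvp fvE eq_sym addr_eq0 => /eqP ->.
  by apply: dividesN; exact: dividesMr (dividesrr a).
(* [n] is a power of 2 beyond the degree of [p], at distance at least [N] from every smaller power
   of 2. *)
pose n := (2 ^ N.+1)%N; have n_gt0 : (0 < n)%N by rewrite expn_gt0.
have le_N : (N <= 2 ^ N)%N by exact/ltnW/ltn_expl.
(* The sum omits the term [h n * coefs v 0 = 1], so [1 - i] is the full sum in [fvE]. *)
pose i := - \sum_(j < n.-1) h j.+1 * coefs v (n - j.+1)%N.
exists i; split.
  rewrite mulNr mulr_suml; apply/dividesN/divides_sum => j _.
  rewrite /h; case: eqP => [jE|_]; last by rewrite !mul0r; exact: divides0.
  rewrite mul1r; apply: va; have := ltn_ord j; rewrite -ltnS prednK // jE.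
  rewrite ltn_exp2l // ltnS => lelN.
  apply: leq_trans le_N _; rewrite leq_subRL ?leq_exp2l //; last exact: leqW.
  rewrite (@leq_trans (2 ^ N + 2 ^ N)) ?leq_add2r ?leq_exp2l //.
  by rewrite addnn -mul2n -expnS.
have -> : 1 - i = \sum_(j < n) h j.+1 * coefs v (n - j.+1)%N.
  rewrite -(prednK n_gt0) big_ord_recr /= prednK // subnn v01 mulr1 opprK addrC.
  by rewrite /h trunc_expnK // eqxx.
have : coefs (f * v) n = 0.
  rewrite fvp nth_default // (leq_trans le_N) // leq_exp2l //.
rewrite fvE addrC => /eqP; rewrite addr_eq0 mulrC => /eqP ->.
by apply: dividesN; exact: dividesMl (dividesrr b).
Qed.

(* With f = sum_n k_n x^n, (a - x) f = a k_0; reading (a - x) p = a k_0 v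
   from the top degree down shows that a k_0 divides p_0 = k_0. *)
Lemma sw_krull a (k : nat -> R) :
  (forall n, k n = a * k n.+1) -> divides (a * k 0%N) (k 0%N).
Proof.
move=> kE; have [v [p [v01 fvp]]] := sw_normalized swR (PSeries k).
have pE n : a * p`_n.+1 - p`_n = a * k 0%N * coefs v n.+1.
  rewrite -!fvp !coef_psM mulr_sumr big_ord_recl /= mulrA -addrA.
  rewrite subn0 -sumrB big1 ?addr0 // => i _.
  by rewrite /bump add1n subSS mulrA -kE subrr.
have dvp n m : (size p <= n + m)%N -> divides (a * k 0%N) p`_n.
  elim: m n => [|m IHm] n.
    by rewrite addn0 => /(nth_default 0) ->; exact: divides0.
  rewrite addnS -addSn => /IHm/(dividesMl a) akp; have /eqP := pE n.
  rewrite subr_eq addrC -subr_eq => /eqP <-.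
  by apply: dividesB => //; exact: dividesMr (dividesrr _).
by have := dvp 0%N (size p) (leqnn _); rewrite -fvp coef_psM0 v01 mulr1.
Qed.

End KrullAndArithmetical.

(** * Connected rings with the strong Weierstrass property are local *)

Definition regular (R : comNzRingType) (a : R) : Prop :=
  forall x, x * a = 0 -> x = 0.

Definition connected_ring (R : comNzRingType) : Prop :=
  forall e : R, e * e = e -> e = 0 \/ e = 1.

Lemma regularX (R : comNzRingType) (a : R) n : regular a -> regular (a ^+ n).
Proof.
move=> rega; elim: n => [|n IHn] x; first by rewrite mulr1.
by rewrite exprSr mulrA => /rega/IHn.
Qed.

Lemma regular_divides (R : comNzRingType) (a b x : R) :
  regular a -> divides (a * b) (a * x) -> divides b x.
Proof.
move=> rega [y axE]; exists y; apply/eqP; rewrite -subr_eq0; apply/eqP/rega.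
by rewrite mulrC mulrBr axE mulrA subrr.
Qed.

Definition separated (R : comNzRingType) (a : R) : Prop :=
  forall x, (forall n, divides (a ^+ n) x) -> x = 0.

(** An element of the a-adic completion, given by representatives [alpha n] modulo [a ^+ n]. *)
Definition coherent (R : comNzRingType) (a : R) (alpha : nat -> R) : Prop :=
  forall n, divides (a ^+ n) (alpha n.+1 - alpha n).

Section Connected.
Variable R : comNzRingType.
Hypothesis swR : strong_weierstrass R.
Implicit Types (a b c : R).

(* H is built coefficient by coefficient so that, in the a-adic completion,
   alpha * H(a * alpha) = 1; then a * alpha is a root of f = - a + x H, hence
   of the polynomial p = - a + x w associated to f. *)
Lemma sw_inverse a (alpha : nat -> R) :
  (forall n, divides a (alpha n - 1)) -> coherent a alpha ->
  exists w : {poly R}, divides a (w`_0 - 1) /\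
    forall n, divides (a ^+ n.+1) (a * (alpha n * w.[a * alpha n] - 1)).
Proof.
move=> alpha1 alphaS.
pose ev n (s : nat -> R) y := \sum_(i < n) s i * y ^+ i.
pose Q n s := divides (a ^+ n) (alpha n * ev n s (a * alpha n) - 1).
have [|s|n s [c Qns]|s Qs] := @greedy_seq R 0 Q.
- move=> n s s' ss'; rewrite /Q.
  suff -> : ev n s (a * alpha n) = ev n s' (a * alpha n) by [].
  by apply: eq_bigr => i _; rewrite ss'.
- exact: divides1l.
- have [d dE] : divides (a ^+ n) (alpha n.+1 * ev n s (a * alpha n.+1) - 1).
    have -> : alpha n.+1 * ev n s (a * alpha n.+1) - 1 =
      (alpha n.+1 - alpha n) * ev n s (a * alpha n.+1) +
      alpha n * (ev n s (a * alpha n.+1) - ev n s (a * alpha n)) +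
      (alpha n * ev n s (a * alpha n) - 1) by ring.
    apply: dividesD; last by exists c.
    apply: dividesD; first exact: dividesMr (alphaS n).
    apply: dividesMl; rewrite /ev -!horner_poly; apply: divides_horner.
    by rewrite -mulrBr; exact: dividesMl (alphaS n).
  (* As [alpha] is 1 modulo [a], the coefficient [- d] cancels the error [a ^+ n * d] modulo
     [a ^+ n.+1]. *)
  exists (- d); rewrite /Q /ev big_ord_recr /= ltnn.
  rewrite (eq_bigr (fun i : 'I_n => s i * (a * alpha n.+1) ^+ i)); last first.
    by move=> i _; rewrite ltn_ord.
  rewrite -/(ev n s _) mulrDr addrAC dE exprMn exprSr.
  have -> : a ^+ n * d + alpha n.+1 * (- d * (a ^+ n * alpha n.+1 ^+ n)) =
    (a ^+ n) * (- d * (alpha n.+1 ^+ n.+1 - 1)) by rewrite exprS; ring.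
  apply: dividesM (dividesrr _) _; apply: dividesMl.
  by rewrite subrX1; exact: dividesMr (alpha1 _).
pose f := PSeries (fun n => if n is m.+1 then s m else - a).
have [v [p [v01 fvp]]] := sw_normalized swR f.
have p0 : p`_0 = - a by rewrite -fvp coef_psM0 v01 mulr1.
pose w := drop_poly 1 p.
have pE y : p.[y] = y * w.[y] - a.
  rewrite -[in LHS](poly_take_drop 1 p) hornerD hornerM hornerX mulrC addrC.
  congr (_ + _); rewrite -p0 -[RHS](hornerC _ y); congr (_.[_]).
  by apply/polyP=> -[|i]; rewrite coef_take_poly coefC.
exists w; split.
  (* Here [w_0 = p_1 = - a v_1 + s_0], and [Q 1] makes [s_0] congruent to 1 modulo [a]. *)
  rewrite coef_drop_poly -fvp coef_psM !big_ord_recl big_ord0 /= v01.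
  have -> : - a * coefs v 1%N + (s 0%N * 1 + 0) - 1 =
    - a * coefs v 1%N + (alpha 1%N * s 0%N - 1) - (alpha 1%N - 1) * s 0%N by ring.
  apply: dividesB; last exact: dividesMr.
  apply: dividesD; first by rewrite mulNr; exact/dividesN/dividesMr/dividesrr.
  by have := Qs 1%N; rewrite /Q /ev big_ord1 expr0 expr1 mulr1.
move=> n; set y := a * alpha n.
have -> : a * (alpha n * w.[y] - 1) = p.[y] by rewrite pE /y; ring.
(* Since [a] divides [y], evaluation at [y] modulo [a ^+ n.+1] depends only on truncations, where
   [p] is the product of [f] and [v]. *)
have yX : divides (a ^+ n.+1) (y ^+ n.+1) by exact/divides_exp/dividesMr/dividesrr.
have [r pr] := ps_trunc_poly n.+1 p; have [r' fvr'] := ps_truncM n.+1 f v.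
have fvE : pseries_of_poly p = f * v by apply: pseriesP => i; rewrite fvp.
rewrite pr fvE hornerD hornerM hornerXn; apply: dividesD; last exact: dividesMl.
have -> : ps_trunc n.+1 (f * v) =
    ps_trunc n.+1 f * ps_trunc n.+1 v - r' * 'X^(n.+1).
  by rewrite fvr' addrK.
rewrite hornerD hornerN !hornerM hornerXn; apply: dividesB; last exact: dividesMl.
apply: dividesMr; rewrite horner_poly big_ord_recl /= expr0 mulr1.
have -> : \sum_(i < n) s i * y ^+ bump 0 i = y * ev n s y.
  by rewrite mulr_sumr; apply: eq_bigr => i _; rewrite exprS mulrCA.
have -> : - a + y * ev n s y = a * (alpha n * ev n s y - 1) by rewrite /y; ring.
by rewrite exprS; apply: dividesM (dividesrr _) (Qs n).
Qed.

(** Let [a'] be a power of [a] whose annihilator is stable. Among the [i] with [i * a' = a'], one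
    with maximal annihilator kills everything that kills [a'], in particular [1 - i]. So [i] is
    idempotent: [i = 0] gives [a' = 0], and [i = 1] makes [a] regular. *)
Lemma sw_nilpotent_or_regular a :
  connected_ring R -> (exists n, a ^+ n = 0) \/ regular a.
Proof.
move=> connR; pose Ann b : set R := [set x | x * b = 0].
have [||_ [[N ->] Nmax]] := @ideal_acc_max R
  [set I | exists n, I = Ann (a ^+ n)] (Ann (a ^+ 0)) (sw_acc swR).
- by move=> _ [n ->]; exact: ann_is_ideal.
- by exists 0%N.
have AnnN n x : (N <= n)%N -> x * a ^+ n = 0 -> x * a ^+ N = 0.
  move=> leNn xan0; apply: (Nmax (Ann (a ^+ n))) => //; first by exists n.
  by move=> y; rewrite /Ann /= -(subnK leNn) exprD mulrCA => ->; rewrite mulr0.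
set a' := a ^+ N.
have Ann2 x : x * a' * a' = 0 -> x * a' = 0.
  by rewrite -mulrA -exprD; apply: AnnN; exact: leq_addr.
have [||_ [[i [ia' ->]] imax]] := @ideal_acc_max R
  [set I | exists i, i * a' = a' /\ I = Ann i] (Ann 1) (sw_acc swR).
- by move=> _ [i [_ ->]]; exact: ann_is_ideal.
- by exists 1; rewrite mul1r.
have iAnn b : b * a' = 0 -> b * i = 0.
  (* Stability of the annihilator upgrades the two divisibilities to [j * b = 0] and [j * a' = a'];
     then [i * j] competes with [i], and its annihilator contains [b]. *)
  move=> ba'0; have [j [[r jb] [s ja']]] := sw_arithmetical swR a' b.
  have jb0 : j * b = 0.
    by rewrite jb mulrC Ann2 // [r * a']mulrC -jb -mulrA ba'0 mulr0.
  have ja'E : j * a' = a'.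
    apply/eqP; rewrite -subr_eq0 -opprB oppr_eq0 -{1}[a']mul1r -mulrBl.
    by rewrite Ann2 // ja' mulrAC ba'0 mul0r.
  apply: (imax (Ann (i * j))).
  - by exists (i * j); rewrite -mulrA ja'E.
  - by move=> x; rewrite /Ann /= mulrA => ->; rewrite mul0r.
  - by rewrite /Ann /= mulrCA [b * j]mulrC jb0 mulr0.
have /connR[i0|i1] : i * i = i.
  apply/eqP; rewrite -subr_eq0 -opprB oppr_eq0 -{1}[i]mul1r -mulrBl.
  by rewrite iAnn // mulrBl mul1r ia' subrr.
- by left; exists N; rewrite -/a' -ia' i0 mul0r.
- right=> x xa0; rewrite -[x]mulr1 -i1 iAnn // (AnnN N.+1) //.
  by rewrite exprS mulrA xa0 mul0r.
Qed.

Hypothesis connR : connected_ring R.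

(** Regularity makes the quotients of [x] by powers of [a] fit [sw_krull], so [x * (1 - a * s) = 0].
    If [1 - a * s] were nilpotent, [a] would be a unit; hence it is regular. *)
Lemma sw_separated a : regular a -> ~ invertible a -> separated a.
Proof.
move=> rega nua x /choice[k xk].
have [n|s] := @sw_krull _ swR a k.
  apply/eqP; rewrite -subr_eq0; apply/eqP/(regularX (n := n) rega).
  by rewrite mulrC mulrBr mulrA -exprSr -!xk subrr.
have -> : k 0%N = x by rewrite [RHS](xk 0%N) mul1r.
move=> xE; have x0 : x * (1 - a * s) = 0.
  by rewrite mulrBr mulr1 {1}xE; ring.
have [[n nil]|/(_ x)->//] := sw_nilpotent_or_regular (1 - a * s) connR.
have := invertible_1Bnil nil; rewrite opprB addrC subrK => /invertibleMl.
by [].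
Qed.

(** For nilpotent [a], a finite geometric series; for regular [a], [sw_inverse] on the constant
    sequence gives an inverse modulo every power of [a], which separatedness makes exact. *)
Lemma sw_jacobson a s : ~ invertible a -> invertible (1 + a * s).
Proof.
move=> nua; have [[n an0]|rega] := sw_nilpotent_or_regular a connR.
  rewrite -[a * s]opprK; apply: (@invertible_1Bnil _ _ n).
  by rewrite exprNn exprMn an0 mul0r mulr0.
set b := 1 + a * s.
have [n|n|w [_ wE]] := @sw_inverse a (fun=> b).
- by exists s; rewrite addrC addKr.
- by rewrite subrr; exact: divides0.
exists w.[a * b]; apply/eqP; rewrite -subr_eq0; apply/eqP.
apply: (sw_separated rega nua) => n; apply: (regular_divides rega).
by rewrite -exprS.
Qed.

Lemma sw_nonunitsD (x y : R) :
  ~ invertible x -> ~ invertible y -> ~ invertible (x + y).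
Proof.
move=> nux nuy [z xyz]; apply: nuy; apply: (@invertibleMl _ _ z).
by rewrite -(addKr x y) mulrDl xyz addrC mulNr -mulrN; exact: sw_jacobson.
Qed.

(** One of [i] and [1 - i] from [sw_arithmetical] is a unit. *)
Lemma sw_chain a b : divides a b \/ divides b a.
Proof.
have [i [ab ba]] := sw_arithmetical swR a b.
have [[j ij]|nui] := pselect (invertible i).
  by left; have := dividesMl j ab; rewrite mulrA [j * i]mulrC ij mul1r.
right; have [j ij] := sw_jacobson (-1) nui.
by have := dividesMl j ba; rewrite mulrA [j * _]mulrC -mulrN1 ij mul1r.
Qed.

(** A maximal principal ideal inside [I] is all of [I], since principal ideals form a chain. *)
Lemma sw_pir : principal_ideal_ring R.
Proof.
move=> I I_ideal; have [I0 _ IM] := I_ideal.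
have [||_ [[c [Ic ->]] cmax]] := @ideal_acc_max R
  [set J | exists c, I c /\ J = divides c] (divides 0) (sw_acc swR).
- by move=> _ [c [_ ->]]; exact: divides_is_ideal.
- by exists 0.
exists c; rewrite principalE; apply/seteqP; split=> [x Ix|x [y ->]]; last first.
  by rewrite mulrC; exact: IM.
have [//|xc] := sw_chain c x.
apply: (cmax (divides x)); [by exists x | | exact: dividesrr].
by move=> y; exact: divides_trans.
Qed.

End Connected.

(** * Completeness *)

(** Existence of limits only; their uniqueness is [separated]. *)
Definition adically_complete (R : comNzRingType) (a : R) : Prop :=
  forall alpha, coherent a alpha ->
  exists s, forall n, divides (a ^+ n) (alpha n - s).

Section Nakayama.
Variable R : comNzRingType.
Implicit Types (a : R) (q c : {poly R}).

(** The determinant is the value at [a] of a polynomial whose value at 0 is 1. *)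
Lemma det_1DZ n a (C : 'M[R]_n) : divides a (\det (1%:M + a *: C) - 1).
Proof.
pose D := \det (1%:M + 'X *: map_mx polyC C).
have DE x : D.[x] = \det (1%:M + x *: C).
  rewrite -[LHS]/(horner_eval x D) -det_map_mx; congr (\det _).
  apply/matrixP=> i j; rewrite !mxE /= /horner_eval hornerD hornerM hornerX hornerC.
  by rewrite -polyC_natr hornerC.
rewrite -DE -[X in _ - X](det1 R n).
have -> : \det (1%:M : 'M[R]_n) = D.[0] by rewrite DE scale0r addr0.
by apply: divides_horner; rewrite subr0; exact: dividesrr.
Qed.

(* Nakayama's lemma for the module generated by the powers of eps, which is
   finitely generated by q and equal to R modulo a by the last hypothesis. *)
Lemma integral_limit a (eps : nat -> R) q c :
  (forall s, invertible (1 + a * s)) -> q \is monic ->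
  (forall n, divides (a ^+ n) q.[eps n]) ->
  (forall n, divides (a ^+ n) (eps n - 1 - a * c.[eps n])) ->
  exists r, forall n, divides (a ^+ n) (eps n - r).
Proof.
move=> jac qmon qeps ceps; pose d := size q.
pose red g := Pdiv.Ring.rmodp g q.
have redP g n : divides (a ^+ n)
    (g.[eps n] - \sum_(j < d) (red g)`_j * eps n ^+ j).
  have lt_d : (size (red g) <= d)%N.
    by apply: ltnW; rewrite Pdiv.Ring.ltn_rmodp monic_neq0.
  rewrite -(horner_coef_wide _ lt_d) {1}(Pdiv.RingMonic.rdivp_eq qmon g).
  by rewrite hornerD hornerM addrK; exact: dividesMl.
(* From [eps ^+ i - 1 = (eps - 1) * \sum_(k < i) eps ^+ k], the matrix [M] sends the vector of
   powers of [eps] to the all-ones vector, modulo [a ^+ n]. *)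
pose C := \matrix_(i < d, j < d) (red (c * \sum_(k < i) 'X^k))`_j.
pose M := 1%:M + a *: - C.
pose V n := \col_(i < d) eps n ^+ i.
have MV n i : divides (a ^+ n) ((M *m V n) i 0 - 1).
  rewrite mulmxDl mul1mx -scalemxAl mulNmx !mxE.
  have -> : \sum_j C i j * V n j 0 =
      \sum_(j < d) (red (c * \sum_(k < i) 'X^k))`_j * eps n ^+ j.
    by apply: eq_bigr => j _; rewrite !mxE.
  set S := \sum_(j < d) _; set g := c * _ in S *.
  have -> : eps n ^+ i + a * - S - 1 = (eps n ^+ i - 1 - a * g.[eps n]) +
    a * (g.[eps n] - S) by ring.
  apply: dividesD; last exact: dividesMl (redP g n).
  rewrite hornerM horner_sum (eq_bigr (fun k : 'I_i => eps n ^+ k)); last first.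
    by move=> k _; rewrite hornerXn.
  by rewrite subrX1 mulrA -mulrBl; exact: dividesMr.
have [t tE] := det_1DZ a (- C); rewrite -/M in tE.
have [D' DD'] := jac t; rewrite -tE addrC subrK in DD'.
(* The inverse of [M] applied to the all-ones vector, hence the limit of [eps ^+ j]. *)
pose r (j : 'I_d) := D' * \sum_k \adj M j k.
have rP n (j : 'I_d) : divides (a ^+ n) (eps n ^+ j - r j).
  have : (\det M *: V n) j 0 = \sum_k \adj M j k * (M *m V n) k 0.
    by rewrite -mul_scalar_mx -mul_adj_mx -mulmxA mxE.
  rewrite !mxE => VE; have -> : eps n ^+ j - r j =
      D' * \sum_k \adj M j k * ((M *m V n) k 0 - 1).
    rewrite (eq_bigr (fun k => \adj M j k * (M *m V n) k 0 - \adj M j k));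
      last first.
      by move=> k _; rewrite mulrBr mulr1.
    by rewrite sumrB mulrBr -VE mulrA [D' * _]mulrC DD' mul1r.
  by apply/dividesMl/divides_sum => k _; exact/dividesMl.
exists (\sum_(j < d) (red 'X)`_j * r j) => n.
have -> : eps n - \sum_(j < d) (red 'X)`_j * r j =
    ('X.[eps n] - \sum_(j < d) (red 'X)`_j * eps n ^+ j) +
    \sum_(j < d) (red 'X)`_j * (eps n ^+ j - r j).
  have -> : \sum_(j < d) (red 'X)`_j * (eps n ^+ j - r j) =
      \sum_(j < d) (red 'X)`_j * eps n ^+ j - \sum_(j < d) (red 'X)`_j * r j.
    by rewrite -sumrB; apply: eq_bigr => j _; rewrite mulrBr.
  by rewrite hornerX; ring.
by apply: dividesD => //; apply: divides_sum => j _; exact: dividesMl.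
Qed.

End Nakayama.

Section Completeness.
Variable R : comNzRingType.
Hypotheses (swR : strong_weierstrass R) (connR : connected_ring R).

(* Applying [sw_inverse] to eps shows that eps is in R + a R[eps]; applying it
   to the inverse of eps shows that eps is integral over R. *)
Lemma sw_complete (a : R) :
  regular a -> ~ invertible a -> adically_complete a.
Proof.
move=> rega nua; have jac s := sw_jacobson swR connR s nua.
(* Replace [alpha] by [1 + a * alpha], whose limit has the form [1 + a * s]; cancelling [a] costs
   one power, hence the index [n.+1] below. *)
suff lim1 eps : (forall n, divides a (eps n - 1)) -> coherent a eps ->
    exists r, forall n, divides (a ^+ n) (eps n - r).
  move=> alpha alphaS; have [n|n|r rP] := lim1 (fun n => 1 + a * alpha n).
  - by rewrite addrC addKr; exact: dividesMr (dividesrr a).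
  - have -> : 1 + a * alpha n.+1 - (1 + a * alpha n) =
      a * (alpha n.+1 - alpha n) by ring.
    exact: dividesMl.
  have [s sE] : divides a (r - 1).
    have -> : r - 1 = a * alpha 1%N - (1 + a * alpha 1%N - r) by ring.
    apply: dividesB; first exact: dividesMr (dividesrr a).
    by have := rP 1%N; rewrite expr1.
  exists s => n.
  have -> : alpha n - s = (alpha n.+1 - s) - (alpha n.+1 - alpha n) by ring.
  apply: dividesB (alphaS n); apply: (regular_divides rega); rewrite -exprS.
  by have := rP n.+1; congr (divides _ _); rewrite mulrBr -sE; ring.
move=> eps1 epsS.
have /choice[eps' eps'P] n : exists y, eps n * y = 1.
  by have [s sE] := eps1 n; have := jac s; rewrite -sE addrC subrK.
have eps'1 n : divides a (eps' n - 1).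
  have -> : eps' n - 1 = - (eps n - 1) * eps' n.
    by rewrite mulNr mulrBl eps'P mul1r opprB.
  exact/dividesMr/dividesN.
have eps'S : coherent a eps'.
  move=> n; have -> : eps' n.+1 - eps' n =
      - (eps n.+1 - eps n) * (eps' n.+1 * eps' n).
    transitivity (eps n * eps' n * eps' n.+1 - eps n.+1 * eps' n.+1 * eps' n);
      last by ring.
    by rewrite !eps'P !mul1r.
  exact/dividesMr/dividesN.
have inv_mod alpha w n : divides (a ^+ n.+1) (a * (alpha * w - 1)) ->
    divides (a ^+ n) (alpha * w - 1).
  by rewrite exprS; exact: regular_divides.
have [w [[t tE] wP]] := sw_inverse swR eps1 epsS.
have [z [_ zP]] := sw_inverse swR eps'1 eps'S.
(* Multiplying [eps' * z(a * eps') = 1] by [eps ^+ N.+1] clears [eps'] and leaves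
   [eps ^+ N.+1 = r(eps)]. *)
pose N := size z; pose r := \sum_(i < N) (z`_i * a ^+ i) *: 'X^(N - i).
(* Obtained by expanding [eps * w(a * eps) = 1] with [w_0 = 1 + a * t]. *)
pose c := - (t *: 'X + 'X^2 * (drop_poly 1 w \Po (a *: 'X))).
have size_r : (size r < size ('X^(N.+1) : {poly R}))%N.
  rewrite size_polyXn ltnS; apply: (leq_trans (size_sum _ _ _)).
  apply/bigmax_leqP => i _.
  apply: leq_trans (size_scale_leq _ _) _.
  by rewrite size_polyXn ltnS leq_subr.
apply: (@integral_limit _ a eps ('X^(N.+1) - r) c) => //.
- by rewrite monicE lead_coefDl ?size_polyN // lead_coefXn.
- move=> n; have -> : ('X^(N.+1) - r).[eps n] =
      - (eps n ^+ N.+1 * (eps' n * z.[a * eps' n] - 1)).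
    rewrite hornerD hornerN hornerXn horner_sum mulrBr mulr1 opprB; congr (_ - _).
    rewrite horner_coef !mulr_sumr; apply: eq_bigr => i _.
    rewrite hornerZ hornerXn exprMn.
    have -> : eps n ^+ N.+1 = eps n ^+ (N - i) * (eps n * eps n ^+ i).
      by rewrite -exprS -exprD addnS subnK // ltnW.
    have -> : eps n ^+ (N - i) * (eps n * eps n ^+ i) *
        (eps' n * (z`_i * (a ^+ i * eps' n ^+ i))) =
      (z`_i * a ^+ i * eps n ^+ (N - i)) * (eps n * eps' n) *
      (eps n ^+ i * eps' n ^+ i) by ring.
    by rewrite -exprMn eps'P expr1n !mulr1.
  by apply/dividesN/dividesMl/inv_mod/zP.
- move=> n; have -> : eps n - 1 - a * c.[eps n] = eps n * w.[a * eps n] - 1.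
    have -> : w.[a * eps n] = w`_0 + (a * eps n) * (drop_poly 1 w).[a * eps n].
      rewrite -[in LHS](poly_take_drop 1 w) hornerD hornerM hornerX addrC.
      rewrite [X in X + _]mulrC addrC; congr (_ + _).
      rewrite -[RHS](hornerC _ (a * eps n)); congr (_.[_]).
      by apply/polyP=> -[|i]; rewrite coef_take_poly coefC.
    rewrite /c hornerN hornerD hornerZ hornerX hornerM hornerXn horner_comp.
    by rewrite hornerZ hornerX -[w`_0](subrK 1) tE; ring.
  exact/inv_mod/wP.
Qed.

End Completeness.

(** * Local principal ideal rings *)

(** A generator of the ideal of nonunits; it may be nilpotent, and is 0 in a field. *)
Definition uniformizer (R : comNzRingType) (pi : R) : Prop :=
  ~ invertible pi /\ forall x, invertible x \/ divides pi x.

Section Uniformizer.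
Variables (R : comNzRingType) (pi : R).
Hypothesis pi_unif : uniformizer pi.

Lemma uniformizer_nonunit x : divides pi x -> ~ invertible x.
Proof. by move=> [y ->] /invertibleMl; have [] := pi_unif. Qed.

Lemma uniformizer_local : local_at (divides pi).
Proof.
have [nupi uVpi] := pi_unif.
have sub J : is_ideal J -> J <> setT -> J `<=` divides pi.
  move=> J_ideal JT x Jx; have [[y xy1]|//] := uVpi x; case: JT.
  have [_ _ JM] := J_ideal; apply: ideal_one_setT => //.
  by rewrite -xy1 mulrC; exact: JM.
have piT : divides pi <> setT.
  move=> dT; apply: (@uniformizer_nonunit 1); first by rewrite dT.
  by exists 1; rewrite mulr1.
split=> [|Q [Q_ideal QT Qmax]].
  split=> //; first exact: divides_is_ideal.
  move=> J J_ideal piJ; have [->|JT] := pselect (J = setT); first by right.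
  by left; apply/seteqP; split=> //; exact: sub.
by case: (Qmax (divides pi) (divides_is_ideal pi) (sub Q Q_ideal QT)).
Qed.

Lemma ideal_exp_divides n : ideal_exp (divides pi) n = divides (pi ^+ n).
Proof.
elim: n => [|n IHn].
  by apply/seteqP; split=> // x _; rewrite expr0; exact: divides1l.
rewrite /ideal_exp iterS -/(ideal_exp _ _) IHn.
apply/seteqP; split=> [x [s sP ->]|x [y ->]].
  rewrite big_seq; apply: divides_sum => p /sP[pi1 pi2].
  by rewrite exprS; exact: dividesM.
exists [:: (pi, pi ^+ n * y)] => [p|].
  rewrite mem_seq1 => /eqP -> /=.
  by split; [exact: dividesrr | exact: dividesMr (dividesrr _)].
by rewrite big_seq1 exprS mulrA.
Qed.

(** Injectivity of the map to the completion is separatedness; surjectivity is the existence of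
    limits, after choosing representatives of the cosets. *)
Lemma complete_atE :
  complete_at (divides pi) <-> separated pi /\ adically_complete pi.
Proof.
rewrite /complete_at /to_completion; split=> [[_ inj surj]|[sep compl]].
  split=> [x xpi|alpha alphaS].
    apply: inj; rewrite ?in_setT //; apply/funext => n; rewrite ideal_exp_divides.
    apply/seteqP; split=> y /=; rewrite /coset /= subr0 => yx.
      by rewrite -(subrK x y); exact: dividesD.
    exact: dividesB.
  have [|s _ sE] := surj (fun n => coset (divides (pi ^+ n)) (alpha n)).
    split=> [n|n x]; first by exists (alpha n); rewrite ideal_exp_divides.
    move=> /(divides_trans (divides_exp_le pi (leqnSn n))) xa.
    by rewrite /coset /= -(subrK (alpha n.+1) x) -addrA; exact: dividesD.
  exists s => n; have /= := congr1 (fun c => c n (alpha n)) sE.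
  rewrite ideal_exp_divides /coset /= => ->.
  by rewrite subrr; exact: divides0.
split=> [s _|x y _ _ xy|c [cE cS]].
- split=> [n|n x]; first by exists s.
  rewrite !ideal_exp_divides /coset /=.
  exact: divides_trans (divides_exp_le _ _).
- apply/eqP; rewrite -subr_eq0; apply/eqP/sep => n.
  have /= := congr1 (fun c => c n x) xy; rewrite ideal_exp_divides /coset /= => <-.
  by rewrite subrr; exact: divides0.
have {cE}/choice[alpha cE] n : exists r, c n = coset (divides (pi ^+ n)) r.
  by rewrite -ideal_exp_divides.
have [n|s sP] := compl alpha.
  have := cS n (alpha n.+1); rewrite !cE /coset /=; apply.
  by rewrite subrr; exact: divides0.
exists s => //; apply/funext => n; rewrite ideal_exp_divides cE.
apply/seteqP; split=> x; rewrite /coset /= => xs.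
  by rewrite -(subrK s x) -addrA; apply: dividesD => //; exact: dividesBC.
by rewrite -(subrK (alpha n) x) -addrA; apply: dividesD.
Qed.

(** A coherent sequence is constant from index [N] on. *)
Lemma nilpotent_complete N : pi ^+ N = 0 -> separated pi /\ adically_complete pi.
Proof.
move=> piN0; split=> [x /(_ N)[y ->]|alpha alphaS]; first by rewrite piN0 mul0r.
have lim m n : divides (pi ^+ n) (alpha (n + m)%N - alpha n).
  elim: m => [|m IHm]; first by rewrite addn0 subrr; exact: divides0.
  rewrite -(subrK (alpha (n + m)%N) (alpha _)) -addrA; apply: dividesD => //.
  by rewrite addnS; apply: divides_trans (alphaS _); apply/divides_exp_le/leq_addr.
exists (alpha N) => n; have [le_nN|/ltnW le_Nn] := leqP n N.
  by rewrite -(subnKC le_nN); apply/dividesBC/lim.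
have [y /eqP] := lim (n - N)%N N; rewrite piN0 mul0r subnKC // => /eqP ->.
exact: divides0.
Qed.

(** Stabilization gives [pi ^+ N * (1 - pi * y) = 0], and [1 - pi * y] is a unit. *)
Lemma artinian_nilpotent : artinian R -> exists N, pi ^+ N = 0.
Proof.
move=> /(_ (fun n => divides (pi ^+ n)))[n|n x|N NE]; first exact: divides_is_ideal.
  exact/divides_trans/divides_exp_le.
exists N; have [y piE] : divides (pi ^+ N.+1) (pi ^+ N).
  by rewrite NE // ; exact: dividesrr.
have [[z z1]|dpi] := pi_unif.2 (1 - pi * y).
  by rewrite -[LHS]mulr1 -z1 mulrA mulrBr mulr1 {1}piE exprSr mulrA subrr mul0r.
have []: ~ invertible (1 : R); last by exists 1; rewrite mulr1.
apply: uniformizer_nonunit; rewrite -(subrK (pi * y) 1); apply: dividesD => //.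
exact: dividesMr (dividesrr _).
Qed.

Lemma uniformizer_factor x :
  separated pi -> x <> 0 -> exists k u, invertible u /\ x = pi ^+ k * u.
Proof.
move=> sep xN0.
have /existsNP[n npi] : ~ forall n, divides (pi ^+ n) x by move=> /sep.
have exn : exists n, ~~ `[<divides (pi ^+ n) x>] by exists n; apply/asboolPn.
case: (ex_minnP exn) => -[|k] /asboolPn nk kmin.
  by case: nk; exact: divides1l.
have /contrapT[u xE] : ~ ~ divides (pi ^+ k) x.
  by move=> /asboolPn/kmin; rewrite ltnn.
exists k, u; split=> //; have [//|[y uE]] := pi_unif.2 u.
by case: nk; exists y; rewrite xE uE exprSr mulrA.
Qed.

(** An ideal is determined by which of the finitely many [pi ^+ k], [k < N], it contains; [t k] is a
    stage by which [pi ^+ k] has left the chain, if it ever does. *)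
Lemma nilpotent_artinian N : pi ^+ N = 0 -> artinian R.
Proof.
move=> piN0; have [sep _] := nilpotent_complete piN0.
move=> I I_ideal IS.
have Idec m n : (m <= n)%N -> I n `<=` I m.
  move=> /subnK <-; elim: (n - m)%N => //= k IHk; rewrite addSn.
  exact: subset_trans (IS _) IHk.
have /choice[t tP] k : exists n, ~ I n (pi ^+ k) \/ forall m, I m (pi ^+ k).
  have [[n nI]|all] := pselect (exists n, ~ I n (pi ^+ k)).
    by exists n; left.
  by exists 0%N; right=> m; apply: contrapT => nI; apply: all; exists m.
exists (\max_(k < N) t k) => n le_n; apply/seteqP; split; first exact: Idec.
move=> x Ix; have [->|/eqP xN0] := eqVneq x 0; first by have [] := I_ideal n.
have [k [u [[y uy1] xE]]] := uniformizer_factor sep xN0.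
have lt_kN : (k < N)%N.
  rewrite ltnNge; apply/negP => le_Nk; apply: xN0.
  by rewrite xE -(subnK le_Nk) exprD piN0 mulr0 mul0r.
suff : I n (pi ^+ k) by rewrite xE mulrC; have [_ _] := I_ideal n; apply.
have [nI|//] := tP k; case: nI.
have le_t : (t k <= \max_(k < N) t k)%N.
  exact: (@leq_bigmax _ (fun k : 'I_N => t k) (Ordinal lt_kN)).
have -> : pi ^+ k = y * x by rewrite xE mulrCA [y * u]mulrC uy1 mulr1.
by have [_ _ IM] := I_ideal (t k); apply/IM/(Idec _ _ le_t).
Qed.

Lemma regular_dvr : principal_ideal_ring R -> separated pi -> regular pi ->
  discrete_valuation_ring R.
Proof.
move=> pirR sep regpi; split=> //.
- move=> x y xy0; apply/orP; have [|/eqP xN0] := eqVneq x 0; first by left.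
  have [|/eqP yN0] := eqVneq y 0; [by right | exfalso].
  have [j [u [[u' uu1] xE]]] := uniformizer_factor sep xN0.
  have [k [v [[v' vv1] yE]]] := uniformizer_factor sep yN0.
  have uv0 : u * v = 0.
    apply: (regularX (n := j + k) regpi).
    by rewrite exprD -xy0 xE yE; ring.
  have := oner_neq0 R; rewrite -[1]mulr1 -[X in X * _]uu1 -vv1.
  by rewrite mulrACA uv0 mul0r eqxx.
- by exists (divides pi); exact: uniformizer_local.
move=> fieldR; apply: pi_unif.1; apply: fieldR; apply/eqP => pi0.
by have := oner_eq0 R; rewrite (regpi 1) ?eqxx // pi0 mulr0.
Qed.

End Uniformizer.

(** A nonunit lies in some maximal ideal, found by the ascending chain condition instead of Zorn's
    lemma, and that ideal is [P]. *)
Lemma local_uniformizer (R : comNzRingType) (P : set R) :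
  local_at P -> principal_ideal_ring R ->
  exists pi, uniformizer pi /\ P = divides pi.
Proof.
move=> [[P_ideal PT Pmax] Puniq] pirR.
have [pi] := pirR P P_ideal; rewrite principalE => PE; exists pi; split=> //.
have nuP x : P x -> ~ invertible x.
  move=> Px [y xy1]; apply: PT; apply: ideal_one_setT => //.
  by rewrite -xy1 mulrC; have [_ _] := P_ideal; apply.
split=> [|x]; first by apply: nuP; rewrite PE; exact: dividesrr.
have [|nux] := pselect (invertible x); [by left | right; rewrite -PE].
have [I [I_ideal _ _]||M [[M_ideal MT xM] Mmax]] := @ideal_acc_max R
  [set I | [/\ is_ideal I, I <> setT & divides x `<=` I]] (divides x)
  (pir_acc pirR).
- by [].
- split=> //; first exact: divides_is_ideal.
  move=> xT; have [y xy1] : divides x 1 by rewrite xT.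
  by apply: nux; exists y.
have <- : M = P.
  apply: Puniq; split=> // J J_ideal MJ.
  have [->|JT] := pselect (J = setT); [by right | left].
  apply/seteqP; split=> //; apply: Mmax => //.
  by split=> //; exact: subset_trans MJ.
by apply: xM; exact: dividesrr.
Qed.

(** The nonunits form an ideal, whose generator is a uniformizer: nilpotent in the Artinian case,
    regular in the valuation ring case. *)
Lemma sw_connected (R : comNzRingType) :
  strong_weierstrass R -> connected_ring R ->
  [/\ principal_ideal_ring R, complete_local_ring R &
      discrete_valuation_ring R \/ artinian R].
Proof.
move=> swR connR; have pirR := sw_pir swR connR.
have [|pi] := pirR [set x | ~ invertible x].
  split=> /= [[y]|x y|r x nux /invertibleMr //]; last exact: sw_nonunitsD.
  by rewrite mul0r => /esym/eqP; rewrite oner_eq0.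
rewrite principalE => nuE.
have pi_unif : uniformizer pi.
  split=> [|x].
    rewrite -[~ _]/([set x | ~ invertible x] pi) nuE; exact: dividesrr.
  have [|nux] := pselect (invertible x); [by left | right].
  by rewrite -nuE.
have local_pi := uniformizer_local pi_unif; have [nupi _] := pi_unif.
have [[N piN0]|regpi] := sw_nilpotent_or_regular swR pi connR.
  split=> //; last by right; exact: (nilpotent_artinian pi_unif piN0).
  exists (divides pi); split=> //; apply/(complete_atE pi).
  exact: nilpotent_complete piN0.
have sep := sw_separated swR connR regpi nupi.
split=> //; last by left; exact: (regular_dvr pi_unif).
exists (divides pi); split=> //; apply/(complete_atE pi).
by split=> //; exact: sw_complete.
Qed.

(** * Decomposition into connected factors *)

Record idempotent (R : comNzRingType) := Idempotent {
  idem_val : R;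
  idem_mulrr : idem_val * idem_val = idem_val;
  idem_neq0 : idem_val != 0
}.

Section Corner.
Variables (R : comNzRingType) (E : idempotent R).
Local Notation e := (idem_val E).

(** The ring [eR] with identity [e], as the fixed points of multiplication by [e]. *)
Definition corner := {x : R | x * e == x}.

HB.instance Definition _ := [Choice of corner by <:].

Implicit Types x y z : corner.

Lemma corner_mule x : \val x * e = \val x.
Proof. exact/eqP/(valP x). Qed.

Let corner_proof r : r * e * e == r * e.
Proof. by rewrite -mulrA idem_mulrr. Qed.

Definition to_corner (r : R) : corner := exist _ (r * e) (corner_proof r).

Lemma val_to_corner r : \val (to_corner r) = r * e.
Proof. by []. Qed.

Lemma to_cornerK x : to_corner (\val x) = x.
Proof. by apply: val_inj; rewrite val_to_corner corner_mule. Qed.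

Let add x y := to_corner (\val x + \val y).
Let opp x := to_corner (- \val x).
Let mul x y := to_corner (\val x * \val y).
Let zero := to_corner 0.
Let one := to_corner 1.

Let valD x y : \val (add x y) = \val x + \val y.
Proof. by rewrite val_to_corner mulrDl !corner_mule. Qed.
Let valN x : \val (opp x) = - \val x.
Proof. by rewrite val_to_corner mulNr corner_mule. Qed.
Let valM x y : \val (mul x y) = \val x * \val y.
Proof. by rewrite val_to_corner -mulrA corner_mule. Qed.
Let val0 : \val zero = 0.
Proof. by rewrite val_to_corner mul0r. Qed.
Let val1 : \val one = e.
Proof. by rewrite val_to_corner mul1r. Qed.

Let addA : associative add.
Proof. by move=> x y z; apply: val_inj; rewrite !valD addrA. Qed.
Let addC : commutative add.
Proof. by move=> x y; apply: val_inj; rewrite !valD addrC. Qed.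
Let add0 : left_id zero add.
Proof. by move=> x; apply: val_inj; rewrite valD val0 add0r. Qed.
Let addN : left_inverse zero opp add.
Proof. by move=> x; apply: val_inj; rewrite valD valN val0 addNr. Qed.
Let mulA : associative mul.
Proof. by move=> x y z; apply: val_inj; rewrite !valM mulrA. Qed.
Let mulC : commutative mul.
Proof. by move=> x y; apply: val_inj; rewrite !valM mulrC. Qed.
Let mul1 : left_id one mul.
Proof. by move=> x; apply: val_inj; rewrite valM val1 mulrC corner_mule. Qed.
Let mulDl : left_distributive mul add.
Proof. by move=> x y z; apply: val_inj; rewrite !(valM, valD) mulrDl. Qed.
Let one_neq0 : one != zero.
Proof. by rewrite -val_eqE val1 val0 idem_neq0. Qed.

HB.instance Definition _ := GRing.isZmodule.Build corner addA addC add0 addN.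
HB.instance Definition _ := GRing.Zmodule_isComNzRing.Build corner
  mulA mulC mul1 mulDl one_neq0.

Let to_corner_is_zmod_morphism : zmod_morphism to_corner.
Proof.
move=> r s; apply: val_inj.
by rewrite [RHS]valD valN !val_to_corner mulrBl.
Qed.

Let to_corner_is_monoid_morphism : monoid_morphism to_corner.
Proof.
split=> // r s; apply: val_inj; rewrite [RHS]valM !val_to_corner.
by rewrite mulrACA idem_mulrr.
Qed.

HB.instance Definition _ :=
  GRing.isZmodMorphism.Build R corner to_corner to_corner_is_zmod_morphism.
HB.instance Definition _ :=
  GRing.isMonoidMorphism.Build R corner to_corner to_corner_is_monoid_morphism.

Lemma corner_connected :
  (forall f : R, f * f = f -> f * e = f -> f = 0 \/ f = e) ->
  connected_ring corner.
Proof.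
move=> prim f ff; have [||f0|fe] := prim (\val f).
- by rewrite -valM; congr (\val _); exact: ff.
- exact: corner_mule.
- by left; apply: val_inj; rewrite f0; exact/esym/val0.
- by right; apply: val_inj; rewrite fe; exact/esym/val1.
Qed.

End Corner.

(** * Transfer to quotients and finite products *)

Section Transfer.
Variables (R S : comNzRingType) (phi : {rmorphism R -> S}).

Definition ps_map (f : pseries R) : pseries S := PSeries (phi \o coefs f).

Lemma ps_mapM f g : ps_map (f * g) = ps_map f * ps_map g.
Proof.
apply: pseriesP => n /=; rewrite rmorph_sum.
by apply: eq_bigr => i _; rewrite rmorphM.
Qed.

Lemma ps_map1 : ps_map 1 = 1.
Proof. by apply: pseriesP => n /=; rewrite rmorph_nat. Qed.

Lemma ps_map_poly p : ps_map (pseries_of_poly p) = pseries_of_poly (map_poly phi p).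
Proof. by apply: pseriesP => n /=; rewrite coef_map. Qed.

Lemma strong_weierstrass_surj :
  (forall y, exists x, phi x = y) -> strong_weierstrass R -> strong_weierstrass S.
Proof.
move=> /choice[psi psiK] swR f.
have [p [u [[v uv1] fE]]] := swR (PSeries (psi \o coefs f)).
exists (map_poly phi p), (ps_map u); split.
  by exists (ps_map v); rewrite -ps_mapM uv1 ps_map1.
rewrite -ps_map_poly -ps_mapM -fE.
by apply: pseriesP => n /=; rewrite psiK.
Qed.

End Transfer.

(** Factorizations are glued coefficientwise; with finitely many factors the degrees are bounded, so
    the glued series is a polynomial. *)
Lemma strong_weierstrass_prod (R : comNzRingType) m (S : 'I_m -> comNzRingType) :
  isomorphic_to_product R S -> (forall i, strong_weierstrass (S i)) ->
  strong_weierstrass R.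
Proof.
move=> [phi [psi phiK psiK]] swS f.
have phi_psi y i : phi i (psi y) = y i by exact: (congr1 (fun c => c i) (psiK y)).
have phi_inj r s : (forall i, phi i r = phi i s) -> r = s.
  by move=> rs; apply: (can_inj phiK); apply: functional_extensionality_dep.
have psphi_inj g h : (forall i, ps_map (phi i) g = ps_map (phi i) h) -> g = h.
  move=> gh; apply: pseriesP => n; apply: phi_inj => i.
  exact: (congr1 (fun k => coefs k n) (gh i)).
have swi i : exists puv : {poly S i} * (pseries (S i) * pseries (S i)),
    puv.2.1 * puv.2.2 = 1 /\ ps_map (phi i) f = pseries_of_poly puv.1 * puv.2.1.
  by have [p [u [[v uv1] fE]]] := swS i (ps_map (phi i) f); exists (p, (u, v)).
pose puv i := projT1 (cid (swi i)).
have puvP i := projT2 (cid (swi i)); rewrite -/(puv _) in puvP.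
pose lift (g : forall i, nat -> S i) := PSeries (fun n => psi (fun i => g i n)).
have liftE g i : ps_map (phi i) (lift g) = PSeries (g i).
  by apply: pseriesP => n /=; rewrite phi_psi.
pose N := \max_(i < m) size (puv i).1.
exists (\poly_(n < N) psi (fun i => (puv i).1`_n)).
exists (lift (fun i => coefs (puv i).2.1)); split.
  exists (lift (fun i => coefs (puv i).2.2)); apply: psphi_inj => i.
  rewrite ps_mapM !liftE ps_map1 -(puvP i).1.
  by case: (puv i).2 => -[u] [v].
apply: psphi_inj => i; rewrite ps_mapM liftE (puvP i).2; congr (_ * _); last first.
  by case: (puv i).2.1.
apply: pseriesP => n /=; rewrite coef_poly; case: ltnP => [_|le_Nn].
  by rewrite phi_psi.
rewrite rmorph0 nth_default //; apply: leq_trans le_Nn.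
exact: (@leq_bigmax _ (fun i => size (puv i).1) i).
Qed.

Definition primitive_idempotent (R : comNzRingType) (e : R) : Prop :=
  [/\ e * e = e, e != 0 &
      forall f : R, f * f = f -> f * e = f -> f = 0 \/ f = e].

Section Decomposition.
Variable R : comNzRingType.

Definition orthogonal_sum (e : R) (s : seq R) : Prop :=
  [/\ forall x, x \in s -> primitive_idempotent x,
      pairwise (fun x y => x * y == 0) s & \sum_(x <- s) x = e].

Lemma orthogonal_sum_mul e s x : orthogonal_sum e s -> x \in s -> x * e = x.
Proof.
move=> [s_prim + <-] xs; elim: s xs s_prim => //= y s IHs.
rewrite in_cons big_cons mulrDr => /predU1P[-> | xs] s_prim /andP[/allP yz pw].
  have [-> _ _] := s_prim y (mem_head _ _).
  rewrite mulr_sumr big_seq big1 ?addr0 // => z /yz/eqP //.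
rewrite IHs // => [|z zs]; last by apply: s_prim; rewrite in_cons zs orbT.
by rewrite mulrC (eqP (yz x xs)) add0r.
Qed.

Lemma orthogonal_sum_cat e f s t :
  e * f = 0 -> orthogonal_sum e s -> orthogonal_sum f t ->
  orthogonal_sum (e + f) (s ++ t).
Proof.
move=> ef0 se tf; have [s_prim s_pw sE] := se; have [t_prim t_pw tE] := tf.
split=> [x||]; last by rewrite big_cat sE tE.
  by rewrite mem_cat => /orP[/s_prim|/t_prim].
rewrite pairwise_cat s_pw t_pw !andbT; apply/allrelP => x y xs yt.
rewrite -(orthogonal_sum_mul se xs) -(orthogonal_sum_mul tf yt).
by rewrite mulrACA [e * f]ef0 mulr0.
Qed.

(** Noetherian induction on the ideal of [1 - e]: a maximal counterexample [e] is nonzero and not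
    primitive, so it splits as [f + (e - f)], and both parts decompose. *)
Lemma acc_orthogonal_sum : ideal_acc R -> exists s, orthogonal_sum 1 s.
Proof.
move=> accR; apply: contrapT => bad1.
pose bad e := e * e = e /\ ~ exists s, orthogonal_sum e s.
have [||_ [[e [[ee bade] ->]] emax]] := @ideal_acc_max R
  [set I | exists e, bad e /\ I = divides (1 - e)] (divides (1 - 1)) accR.
- by move=> _ [e [_ ->]]; exact: divides_is_ideal.
- by exists 1; rewrite /bad mulr1.
have good f : f * f = f -> f * e = f -> f <> e -> exists s, orthogonal_sum f s.
  move=> ff fe fNe; apply: contrapT => badf.
  have [||y fE] := emax (divides (1 - f)) _ _ (1 - f) (dividesrr _).
  - by exists f.
  - move=> _ [y ->]; exists ((1 - e) * y).
    transitivity ((1 - e - f + f * e) * y); last by ring.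
    by rewrite fe addrNK.
  have : e * (1 - f) = 0 by rewrite fE mulrA mulrBr mulr1 ee subrr mul0r.
  by rewrite mulrBr mulr1 mulrC fe => /eqP; rewrite subr_eq0 => /eqP/esym.
have [e0|/eqP eN0] := eqVneq e 0.
  by apply: bade; exists [::]; split; rewrite ?big_nil.
have /existsNP[f] : ~ forall f, f * f = f -> f * e = f -> f = 0 \/ f = e.
  move=> prim; apply: bade; exists [:: e]; split; rewrite ?big_seq1 //= => x.
  by rewrite mem_seq1 => /eqP ->; split=> //; exact/eqP.
move=> /not_implyP[ff] /not_implyP[fe] /not_orP[fN0 fNe].
have [s sf] := good f ff fe fNe.
have [|||t tf] := good (e - f).
- by rewrite mulrBl !mulrBr ee ff mulrC fe subrr subr0.
- by rewrite mulrBl ee fe.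
- by move=> efe; apply: fN0; rewrite -(subKr e f) efe subrr.
apply: bade; exists (s ++ t); rewrite -(subrKC f e).
by apply: orthogonal_sum_cat => //; rewrite mulrBr fe ff subrr.
Qed.

(** The inverse of the product map adds up the components inside [R]. *)
Lemma orthogonal_sum_product s : orthogonal_sum 1 s ->
  exists e : 'I_(size s) -> idempotent R,
    (forall i, primitive_idempotent (idem_val (e i))) /\
    isomorphic_to_product R (fun i => corner (e i)).
Proof.
move=> [s_prim s_pw s1].
have si_prim (i : 'I_(size s)) := s_prim _ (mem_nth 0 (ltn_ord i)).
pose e i := let: And3 ee eN0 _ := si_prim i in Idempotent ee eN0.
have eE i : idem_val (e i) = s`_i by rewrite /e; case: (si_prim i).
exists e; split=> [i|]; first by rewrite eE.
exists (fun i => @to_corner R (e i)).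
have orth (i j : 'I_(size s)) : i != j -> s`_i * s`_j = 0.
  move=> iNj; have /(pairwiseP 0) pw := s_pw.
  have [lt_ij|lt_ji|/val_inj/eqP] := ltngtP i j; last by rewrite (negPf iNj).
    by apply/eqP/pw; rewrite ?inE.
  by rewrite mulrC; apply/eqP/pw; rewrite ?inE.
exists (fun c : forall i, corner (e i) => \sum_i \val (c i)) => [r|c].
  under eq_bigr do rewrite val_to_corner eE.
  by rewrite -mulr_sumr -[RHS]mulr1 -s1 (big_nth 0) big_mkord.
apply: functional_extensionality_dep => i; apply: val_inj.
rewrite val_to_corner mulr_suml (bigD1 i) //= corner_mule big1 ?addr0 // => j jNi.
have eji0 : idem_val (e j) * idem_val (e i) = 0 by rewrite !eE orth.
by rewrite -corner_mule -mulrA eji0 mulr0.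
Qed.

End Decomposition.

Lemma sw_product (R : comNzRingType) : strong_weierstrass R ->
  exists (m : nat) (S : 'I_m -> comNzRingType), isomorphic_to_product R S /\
    forall i, [/\ principal_ideal_ring (S i), complete_local_ring (S i) &
      discrete_valuation_ring (S i) \/ artinian (S i)].
Proof.
move=> swR; have [s s1] := acc_orthogonal_sum (sw_acc swR).
have [e [e_prim R_prod]] := orthogonal_sum_product s1.
exists (size s), (fun i => corner (e i)); split=> // i.
have [_ _ prim] := e_prim i; apply: sw_connected (corner_connected prim).
apply: (@strong_weierstrass_surj _ _ (@to_corner R (e i))) swR => y.
by exists (\val y); exact: to_cornerK.
Qed.

(** * Weierstrass preparation *)

Section WeierstrassPreparation.
Variables (R : comNzRingType) (pi : R).
Hypotheses (pi_unif : uniformizer pi) (pi_sep : separated pi).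
Hypothesis pi_complete : adically_complete pi.
Implicit Types f g u : pseries R.

Lemma coef_psXnM d f n : coefs (pseries_of_poly 'X^d * f) n =
  if (n < d)%N then 0 else coefs f (n - d)%N.
Proof.
rewrite coef_psM; case: ltnP => [lt_nd|le_dn].
  rewrite big1 // => i _; rewrite /= coefXn ltn_eqF ?mul0r //.
  exact: leq_trans (ltn_ord i) lt_nd.
rewrite (bigD1 (Ordinal (le_dn : d < n.+1)%N)) //= coefXn eqxx mul1r.
rewrite big1 ?addr0 // => i iNd; rewrite coefXn.
by rewrite -[(i == d :> nat)]/(i == Ordinal (le_dn : d < n.+1)%N) (negPf iNd) mul0r.
Qed.

Lemma coef_psM_divides b f g u :
  (forall m, divides b (coefs f m - coefs g m)) ->
  forall m, divides b (coefs (f * u) m - coefs (g * u) m).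
Proof.
move=> fg m; rewrite !coef_psM -sumrB; apply: divides_sum => i _.
by rewrite -mulrBl; exact: dividesMr.
Qed.

(* Write g = pi g' + x^d h with h a unit. The contraction
   Q |-> 1 - pi * shift_d (Q g' / h) has a fixed point Q, and then Q / h is a
   unit such that (Q / h) g is a polynomial of degree d. *)
Lemma weierstrass_preparation g d :
  invertible (coefs g d) -> (forall i, (i < d)%N -> divides pi (coefs g i)) ->
  exists (p : {poly R}) u, invertible u /\ g = pseries_of_poly p * u.
Proof.
move=> gd_unit g_lt.
have /choice[y yP] i : exists y, (i < d)%N -> coefs g i = pi * y.
  by case: ltnP => [/g_lt[y]|_]; [exists y | exists 0].
pose g' := PSeries (fun i => if (i < d)%N then y i else 0).
pose h := PSeries (fun n => coefs g (n + d)%N).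
have gE : g = pseries_of_poly pi%:P * g' + pseries_of_poly 'X^d * h.
  apply: pseriesP => n; rewrite coef_psD coef_psCM coef_psXnM /=.
  by case: ltnP => [/yP->|le_dn]; rewrite ?addr0 // mulr0 add0r subnK.
have [l hl1] : invertible h by exact: ps_invertible.
pose k := g' * l.
pose T Q := PSeries (fun n => (n == 0%N)%:R - pi * coefs (Q * k) (n + d)%N).
have TE Q m : coefs (T Q) m = (m == 0%N)%:R - pi * coefs (Q * k) (m + d)%N by [].
have T_contr b Q Q' : (forall m, divides b (coefs Q m - coefs Q' m)) ->
    forall m, divides (pi * b) (coefs (T Q) m - coefs (T Q') m).
  move=> QQ' m.
  have -> : coefs (T Q) m - coefs (T Q') m =
      - (pi * (coefs (Q * k) (m + d) - coefs (Q' * k) (m + d))).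
    by rewrite !TE; ring.
  by apply/dividesN/(dividesM (dividesrr _)); exact: coef_psM_divides.
have TS n m : divides (pi ^+ n) (coefs (iter n.+1 T 0) m - coefs (iter n T 0) m).
  elim: n m => [|n IHn] m; first exact: divides1l.
  by rewrite exprS; exact: T_contr.
(* The fixed point is the coefficientwise limit of the iterates of [T] from 0. *)
have /choice[q qP] m : exists s, forall n,
    divides (pi ^+ n) (coefs (iter n T 0) m - s).
  exact: pi_complete (fun n => TS n m).
pose Q := PSeries q.
have QE m : coefs Q m = (m == 0%N)%:R - pi * coefs (Q * k) (m + d)%N.
  rewrite -TE; apply/eqP; rewrite -subr_eq0; apply/eqP/pi_sep => n.
  have -> : coefs Q m - coefs (T Q) m =
     (coefs (iter n.+1 T 0) m - coefs (T Q) m) -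
     (coefs (iter n.+1 T 0) m - coefs Q m) by ring.
  apply: divides_trans (divides_exp_le pi (leqnSn n)) _.
  apply: dividesB (qP m n.+1).
  by rewrite exprS; apply: T_contr => j; exact: qP.
have [w Qlw1] : invertible (Q * l).
  apply: ps_invertible; rewrite coef_psM0; apply: invertibleM; last first.
    exists (coefs h 0%N); rewrite mulrC -coef_psM0 hl1 //.
  have [//|piQ] := pi_unif.2 (coefs Q 0%N); exfalso.
  apply: (uniformizer_nonunit pi_unif (x := 1)); last by exists 1; rewrite mulr1.
  have -> : 1 = coefs Q 0%N + pi * coefs (Q * k) d by rewrite QE subrK.
  by apply: dividesD => //; exact: dividesMr (dividesrr _).
pose p := \poly_(i < d.+1) coefs (g * (Q * l)) i; exists p, w; split.
  by exists (Q * l); rewrite mulrC.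
rewrite -[g in LHS]mulr1 -Qlw1 mulrA; congr (_ * _).
apply: pseriesP => n; rewrite -[RHS]/(p`_n) coef_poly ltnS; case: leqP => // lt_dn.
(* Above degree [d] the two summands cancel, by the fixed point equation [QE]. *)
have -> : g * (Q * l) = pseries_of_poly pi%:P * (Q * k) + pseries_of_poly 'X^d * Q.
  rewrite [in LHS]gE mulrDl -!mulrA; congr (_ * _ + _ * _); rewrite /k.
    by rewrite mulrCA.
  by rewrite mulrCA hl1 mulr1.
rewrite coef_psD coef_psCM coef_psXnM ltnNge ltnW //= -/(coefs Q _).
rewrite -[q _]/(coefs Q (n - d)) QE subnK ?(ltnW lt_dn) //.
by rewrite subn_eq0 leqNgt lt_dn sub0r subrr.
Qed.

(** For nonzero [f], divide by the largest [pi ^+ k] dividing all coefficients; the quotient has a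
    unit coefficient, and preparation applies at the first one. *)
Lemma complete_strong_weierstrass : strong_weierstrass R.
Proof.
move=> f; have [f0|/existsNP[n0 fn0]] := pselect (forall n, coefs f n = 0).
  exists 0, 1; split; first by exists 1; rewrite mulr1.
  by rewrite mulr1; apply: pseriesP => n; rewrite f0 /= coef0.
have exk : exists k, ~~ `[<forall n, divides (pi ^+ k) (coefs f n)>].
  have [k [u [u_unit fE]]] := uniformizer_factor pi_unif pi_sep fn0.
  apply: contrapT => none; apply: fn0; apply: pi_sep => j.
  have /contrapT/asboolP : ~ ~ `[<forall n, divides (pi ^+ j) (coefs f n)>].
    by move=> nj; apply: none; exists j; exact/negP.
  exact.
case: (ex_minnP exk) => -[|k] /asboolPn/existsNP[m nk] kmin.
  by case: nk; exact: divides1l.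
have fk n : divides (pi ^+ k) (coefs f n).
  have /contrapT/asboolP : ~ ~ `[<forall n, divides (pi ^+ k) (coefs f n)>].
    by move=> /negP/kmin; rewrite ltnn.
  exact.
have /choice[g gE] := fk.
have exd : exists n, `[<invertible (g n)>].
  exists m; apply/asboolP; have [//|pig] := pi_unif.2 (g m).
  by case: nk; rewrite gE exprSr; exact: dividesM (dividesrr _) pig.
case: (ex_minnP exd) => d /asboolP gd_unit dmin.
have [|p [u [u_unit guE]]] := @weierstrass_preparation (PSeries g) d gd_unit.
  move=> i lt_id; have [/asboolP/dmin|//] := pi_unif.2 (g i).
  by rewrite leqNgt lt_id.
exists ((pi ^+ k)%:P * p), u; split=> //.
rewrite pseries_of_polyM -mulrA -guE; apply: pseriesP => n.
by rewrite coef_psCM gE.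
Qed.

End WeierstrassPreparation.

(** * The characterization *)

Lemma complete_local_pir_sw (R : comNzRingType) :
  complete_local_ring R -> principal_ideal_ring R -> strong_weierstrass R.
Proof.
move=> [P [locP complP]] pirR.
have [pi [pi_unif PE]] := local_uniformizer locP pirR.
rewrite PE in complP; have [sep compl] := (complete_atE pi).1 complP.
exact: complete_strong_weierstrass compl.
Qed.

Lemma artinian_local_pir_sw (R : comNzRingType) :
  artinian R -> local_ring R -> principal_ideal_ring R -> strong_weierstrass R.
Proof.
move=> artR [P locP] pirR.
have [pi [pi_unif _]] := local_uniformizer locP pirR.
have [N piN0] := artinian_nilpotent pi_unif artR.
have [sep compl] := nilpotent_complete piN0.
exact: complete_strong_weierstrass compl.
Qed.

Theorem theorem1p1 (R : comNzRingType) :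
  (strong_weierstrass R <-> complete_principal_ideal_ring R) /\
  (strong_weierstrass R <->
   exists (m : nat) (S : 'I_m -> comNzRingType),
     isomorphic_to_product R S /\
     forall i : 'I_m,
       (discrete_valuation_ring (S i) /\ complete_local_ring (S i)) \/
       [/\ artinian (S i), local_ring (S i) & principal_ideal_ring (S i)]).
Proof.
split; split.
- move=> /sw_product[m [S [R_prod SP]]]; exists m, S; split=> // i.
  by have [] := SP i.
- move=> [m [S [R_prod SP]]]; apply: strong_weierstrass_prod R_prod _ => i.
  by have [] := SP i; exact: complete_local_pir_sw.
- move=> /sw_product[m [S [R_prod SP]]]; exists m, S; split=> // i.
  have [pirS complS [dvrS|artS]] := SP i; [by left | right; split=> //].
  by have [P [locP _]] := complS; exists P.
- move=> [m [S [R_prod SP]]]; apply: strong_weierstrass_prod R_prod _ => i.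
  have [[[_ pirS _ _] complS]|[artS locS pirS]] := SP i.
    exact: complete_local_pir_sw.
  exact: artinian_local_pir_sw.
Qed.
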